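(* Let $h$ be a convex normal integrand on $[0,T]\times\mathbb{R}^d$ and $\mu$ a positive atomless Radon measure on $[0,T]$ with support $[0,T]$. Assume that the set-valued mapping $t\mapsto \operatorname{dom} h_t$ is left-inner semicontinuous, and that for every $x\in X$, $$x\in \operatorname{int} L^\infty(\operatorname{dom} h)\ \Longrightarrow\ x\in \operatorname{dom} I_h\ \Longrightarrow\ x_t\in \operatorname{cl}\operatorname{dom} h_t\ \ \forall t\in[0,T].$$ If $I_h$ is proper on $X$ (i.e. $I_h>-\infty$ on $X$ and $I_h\not\equiv+\infty$ on $X$) and $X\cap \operatorname{int} L^\infty(\operatorname{dom} h)\neq\emptyset$, then $$\inf_{x\in X}\int_{[0,T]} h_t(x_t)\,d\mu_t=\int_{[0,T]}\inf_{x\in\mathbb{R}^d} h_t(x)\,d\mu_t .$$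
   Context: Fix $T>0$, $d\ge1$. $X$ is the space of left-continuous functions $x:\mathbb{R}\to\mathbb{R}^d$ of bounded variation that are constant on $(-\infty,0]$ and on $(T,\infty)$. A convex normal integrand on $[0,T]\times\mathbb{R}^d$ is a function $h:[0,T]\times\mathbb{R}^d\to\mathbb{R}\cup\{+\infty\}$, $(t,x)\mapsto h_t(x)$, such that each $h_t$ is convex and $t\mapsto \operatorname{epi}h_t=\{(x,\alpha): h_t(x)\le\alpha\}$ is closed-valued and Borel measurable (inverse images of open sets are Borel). $\operatorname{dom}h_t=\{x\in\mathbb{R}^d: h_t(x)<\infty\}$. For measurable $x:[0,T]\to\mathbb{R}^d$, $I_h(x):=\int_{[0,T]} h_t(x_t)\,d\mu_t$, where the integral is defined as $+\infty$ unless the positive part of the integrand is integrable; $\operatorname{dom} I_h=\{x: I_h(x)<\infty\}$. Let $\tau$ be the topology on $[0,T]$ generated by the left-open intervals $(s,t]$; a set-valued mapping $S:[0,T]\rightrightarrows\mathbb{R}^d$ is left-inner semicontinuous if $\{t: S_t\cap A\ne\emptyset\}$ is $\tau$-open for every open $A\subseteq\mathbb{R}^d$. For a measurable set-valued $S$, $L^\infty(S):=\{x\in L^\infty([0,T],\mu;\mathbb{R}^d): x_t\in S_t\ \mu\text{-a.e.}\}$, and $\operatorname{int}$ denotes interior in the norm topology of $L^\infty([0,T],\mu;\mathbb{R}^d)$ (elements of $X$ are identified with their $\mu$-equivalence classes on $[0,T]$). *)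

(* Defs.v *)
From mathcomp Require Import all_boot all_order all_algebra.
From mathcomp Require Import all_classical all_reals all_analysis.
Import Order.TTheory GRing.Theory Num.Theory.
Import numFieldNormedType.Exports.

Set Implicit Arguments.
Unset Strict Implicit.
Unset Printing Implicit Defensive.

Local Open Scope ring_scope.
Local Open Scope classical_set_scope.

Section Defs.
Context {R : realType} {d : nat}.

Definition I0T (T : R) : set R := `[0%R, T].

Definition bv_on_R (x : R -> 'rV[R]_d) : Prop :=
  exists M : R, forall s : seq R, sorted <%R s ->
    \sum_(i < (size s).-1) `|x (nth 0 s i.+1) - x (nth 0 s i)| <= M.

Definition left_continuous (x : R -> 'rV[R]_d) : Prop :=
  forall t : R, x s @[s --> t^'-] --> x t.

Definition spaceX (T : R) : set (R -> 'rV[R]_d) :=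
  [set x | [/\ left_continuous x, bv_on_R x,
             (forall s, s <= 0 -> x s = x 0) &
             (forall s u, T < s -> T < u -> x s = x u)]].

Definition epi (h : R -> 'rV[R]_d -> \bar R) (t : R) : set ('rV[R]_d * R) :=
  [set p | (h t p.1 <= p.2%:E)%E].

Definition domh (h : R -> 'rV[R]_d -> \bar R) (t : R) : set 'rV[R]_d :=
  [set x | (h t x < +oo)%E].

Definition convex_normal_integrand (T : R) (h : R -> 'rV[R]_d -> \bar R) : Prop :=
  [/\ (forall t, I0T T t -> forall x, h t x != -oo%E),
      (forall t, I0T T t -> forall (x y : 'rV[R]_d) (l : R), 0 <= l <= 1 ->
          (h t (l *: x + (1 - l) *: y)%R <= l%:E * h t x + (1 - l)%:E * h t y)%E),
      (forall t, I0T T t -> closed (epi h t)) &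
      (forall O : set ('rV[R]_d * R), open O ->
          measurable [set t | I0T T t /\ (epi h t `&` O) !=set0])].

Definition Iint (mu : {measure set R -> \bar R}) (T : R) (f : R -> \bar R)
  : \bar R :=
  if (\int[mu]_(t in I0T T) f^\+ t < +oo)%E
  then (\int[mu]_(t in I0T T) f t)%E else +oo%E.

Definition Ih (mu : {measure set R -> \bar R}) (T : R)
  (h : R -> 'rV[R]_d -> \bar R) (x : R -> 'rV[R]_d) : \bar R :=
  Iint mu T (fun t => h t (x t)).

Definition measurable_vec (T : R) (y : R -> 'rV[R]_d) : Prop :=
  forall i : 'I_d, measurable_fun (I0T T) (fun t => y t 0 i).

Definition in_int_Linf_dom (mu : {measure set R -> \bar R}) (T : R)
  (h : R -> 'rV[R]_d -> \bar R) (x : R -> 'rV[R]_d) : Prop :=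
  exists2 e : R, 0 < e &
    forall y : R -> 'rV[R]_d, measurable_vec T y ->
      (forall t, I0T T t -> `|y t - x t| <= e) ->
      {ae mu, forall t, I0T T t -> domh h t (y t)}.

(** open sets of the topology tau on [0,T] generated by the intervals (s,t] *)
Definition tau_open (T : R) (U : set R) : Prop :=
  U `<=` I0T T /\
  forall t, U t -> exists2 s, s < t & forall r, s < r -> r <= t -> 0 <= r -> U r.

Definition left_inner_semicontinuous (T : R) (S : R -> set 'rV[R]_d) : Prop :=
  forall A : set 'rV[R]_d, open A ->
    tau_open T [set t | I0T T t /\ (S t `&` A) !=set0].

Definition radon_on (mu : {measure set R -> \bar R}) (T : R) : Prop :=
  (mu (I0T T) < +oo)%E.

Definition atomless_on (mu : {measure set R -> \bar R}) (T : R) : Prop :=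
  forall A : set R, measurable A -> A `<=` I0T T -> (0 < mu A)%E ->
    exists2 B : set R, measurable B /\ B `<=` A & (0 < mu B < mu A)%E.

Definition support_is (mu : {measure set R -> \bar R}) (T : R) : Prop :=
  forall U : set R, open U -> (U `&` I0T T) !=set0 ->
    (0 < mu (U `&` I0T T))%E.

End Defs.

(* Main.v *)
Require Import Defs.
From mathcomp Require Import all_boot all_order all_algebra.
From mathcomp Require Import all_classical all_reals all_analysis.
From mathcomp Require Import measurable_realfun ring lra.
Import Order.TTheory GRing.Theory Num.Theory.
Import numFieldNormedType.Exports.
Local Open Scope ring_scope.
Local Open Scope classical_set_scope.

(**
   Proof idea. Only the upper bound on the infimum is at stake.

   (1) There is a countable family [x_n] in [X] with finite [I_h(x_n)] and
   [inf_n h_t(x_n t) <= inf h_t] for almost every [t]: start from [x0] interior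
   to [L^oo(dom h)] and replace it on a left-open rational interval by
   [l x0 + (1 - l) q], with [q] rational and [dom h_t] meeting a small ball
   around [q] throughout the interval.  Such a path is again interior, since a
   cube around [x0 t] lies in [dom h_t].  By left-inner semicontinuity, the set
   where [dom h_t] meets a given ball is exhausted by such intervals up to a
   countable set, which is [mu]-null.

   (2) Let [J] be the L1-closure of the functions [t |-> h_t(x t)], for [x] in
   [X] with finite [I_h(x)].  Since paths of [X] can be spliced at any time, the
   sets [A] such that [J] is stable under [(f, g) |-> 1_A f + 1_(~ A) g] form a
   sigma-algebra containing the rays, hence all Borel sets; so [J] is stable
   under [min].  Monotone convergence along [min_(i <= n) h_t(x_i t)] concludes.
*)

(** * Left half-open topology: countable exhaustion and Borel measurability *)

Section LeftOpen.
Context {R : realType}.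
Implicit Types (V : set R) (t : R).

(** Openness on the whole line for the topology generated by the intervals []s, t]], the analogue of
    [tau_open] without the restriction to [0,T]. *)
Definition left_open V := forall t, V t -> exists2 s, s < t & `]s, t] `<=` V.

Definition ratcell (p : rat * rat) : set R := `]ratr p.1, ratr p.2].

Definition ratcells V : set R :=
  \bigcup_(p in [set p | ratcell p `<=` V]) ratcell p.

(** Attach to each missed point [t] a rational [a] with []a, t]] inside [V]. If [t < t'] shared the
    same [a], a rational [b] between them would give a cell []a, b]] inside [V] containing [t]. So
    each [a] serves at most one missed point. *)
Lemma left_open_ratcells V : left_open V -> countable (V `\` ratcells V).
Proof.
move=> oV.
pose N (a : rat) := [set t | [/\ V t, ~ ratcells V t, ratr a < t &
  `]ratr a, t] `<=` V]].
suff cN a : countable (N a).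
  apply: (@sub_countable _ _ _ (\bigcup_a N a)); last exact: bigcup_countable.
  apply: subset_card_le => t [Vt Nt].
  have [s st sV] := oV _ Vt.
  have [a] := rat_in_itvoo st; rewrite in_itv/= => /andP[sa at_].
  exists a => //; split => // r; rewrite /= in_itv/= => /andP[ar rt].
  by apply: sV; rewrite /= in_itv/= rt (lt_trans sa).
have uniqN t t' : N a t -> N a t' -> ~ t < t'.
  move=> [Vt Nt at_ aV] [Vt' Nt' at'_ aV'] tt'.
  have [b] := rat_in_itvoo tt'; rewrite in_itv/= => /andP[tb bt'].
  apply: Nt; exists (a, b); last by rewrite /ratcell/= in_itv/= at_ ltW.
  move=> r; rewrite /ratcell/= in_itv/= => /andP[ar rb].
  by apply: aV'; rewrite /= in_itv/= ar (le_trans rb)// ltW.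
have [->|/set0P[t Nt]] := eqVneq (N a) set0; first exact: countable0.
apply: (@sub_countable _ _ _ [set t]); last exact/finite_set_countable/finite_set1.
apply: subset_card_le => t' Nt' /=.
by case: (ltgtP t' t) => // tt'; [case: (uniqN _ _ Nt' Nt)|case: (uniqN _ _ Nt Nt')].
Qed.

Lemma measurable_left_open V : left_open V -> measurable V.
Proof.
move=> oV; rewrite (_ : V = ratcells V `|` (V `\` ratcells V)); last first.
  by apply/esym/setDUK => t [p /= pV]; exact: pV.
apply: measurableU; last first.
  by apply: countable_measurable; [exact: measurable_set1|exact: left_open_ratcells].
rewrite /ratcells bigcup_mkcond; apply: countable_bigcupT_measurable.
  exact: countableP.
by move=> p; case: ifP => _; [exact: measurable_itv|exact: measurable0].
Qed.

End LeftOpen.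

(** * Paths in X: splicing, affine images, measurability *)

Section Paths.
Context {R : realType} {d : nat} (T : R).
Implicit Types x y : R -> 'rV[R]_d.

Lemma left_continuousP x t (O : set 'rV[R]_d) :
  left_continuous x -> open O -> O (x t) ->
  exists2 s, s < t & forall r, s < r <= t -> O (x r).
Proof.
move=> cx oO Ot.
have : \forall s \near t^'-, O (x s) by apply: cx; exact: open_nbhs_nbhs.
move=> [e /= e0 He]; exists (t - e); first by rewrite ltrBlDr ltrDl.
move=> r /andP[r1]; rewrite le_eqVlt => /predU1P[->//|r2].
by apply: He => //=; rewrite /ball_/= ger0_norm ?subr_ge0 1?ltW// ltrBlDl -ltrBlDr.
Qed.

Lemma left_open_preimage x (O : set 'rV[R]_d) :
  left_continuous x -> open O -> left_open (x @^-1` O).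
Proof.
move=> cx oO t Ot; have [s st sO] := left_continuousP _ t O cx oO Ot.
by exists s => // r /=; rewrite in_itv/=; exact: sO.
Qed.

Lemma bv_on_R_bounded x : bv_on_R x -> exists M, forall t, `|x t| <= M.
Proof.
move=> [M xM]; exists (M + `|x 0|) => t.
rewrite -lerBlDr (le_trans (lerB_dist _ _))//.
have [t0|t0|->] := ltgtP t 0.
- have /= := xM [:: t; 0]; rewrite /= andbT t0 big_ord_recl big_ord0 /= addr0 => /(_ isT).
  by rewrite distrC.
- by have := xM [:: 0; t]; rewrite /= andbT t0 big_ord_recl big_ord0 /= addr0 => /(_ isT).
- rewrite subrr normr0; have /= := xM [::] isT.
  by rewrite big_ord0.
Qed.

(** The value at [c] itself comes from [x], which is what preserves left continuity. *)
Definition cut c x y : R -> 'rV[R]_d := fun t => if t <= c then x t else y t.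

(* The jump at [c] is charged to the decreasing indicator of [t <= c], whose
   increments telescope. *)
Lemma bv_on_R_cut c x y : bv_on_R x -> bv_on_R y -> bv_on_R (cut c x y).
Proof.
move=> bx by_.
have [Cx xC] := bv_on_R_bounded _ bx; have [Cy yC] := bv_on_R_bounded _ by_.
have [Mx xM] := bx; have [My yM] := by_.
pose u (t : R) : R := (t <= c)%R%:R.
have C0 : 0 <= Cx + Cy.
  by rewrite addr_ge0// ?(le_trans (normr_ge0 _) (xC 0))// (le_trans (normr_ge0 _) (yC 0)).
exists (Mx + My + (Cx + Cy)) => s ss.
have step (a b : R) : a < b -> `|cut c x y b - cut c x y a| <=
    `|x b - x a| + `|y b - y a| + (Cx + Cy) * (u a - u b).
  move=> ab; rewrite /cut /u.
  have [bc|cb] := leP b c.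
    by rewrite (le_trans (ltW ab) bc) subrr mulr0 addr0 lerDl.
  have [ac|ca] := leP a c; last by rewrite subrr mulr0 addr0 lerDr.
  rewrite subr0 mulr1 (le_trans (ler_normB _ _))//.
  by rewrite addrC (le_trans (lerD (xC a) (yC b)))// lerDr addr_ge0.
apply: (@le_trans _ _ (\sum_(i < (size s).-1)
   (`|x (nth 0 s i.+1) - x (nth 0 s i)| + `|y (nth 0 s i.+1) - y (nth 0 s i)| +
    (Cx + Cy) * (u (nth 0 s i) - u (nth 0 s i.+1))))).
  apply: ler_sum => i _; apply: step.
  have si : (i.+1 < size s)%N by rewrite -ltn_predRL.
  by apply: (sorted_ltn_nth lt_trans 0 ss) => //; rewrite inE// ltnW.
rewrite !big_split/= !lerD//; [exact: xM|exact: yM|].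
rewrite -mulr_sumr ler_piMr//.
rewrite -(big_mkord xpredT (fun i => u (nth 0 s i) - u (nth 0 s i.+1))).
rewrite -[leLHS]opprK -sumrN.
under eq_bigr do rewrite opprB.
rewrite telescope_sumr// opprB /u.
by do 2 case: (_ <= c) => //=; rewrite ?subrr ?subr0 ?sub0r ?lerN10// ler01.
Qed.

Lemma left_continuous_cut c x y :
  left_continuous x -> left_continuous y -> left_continuous (cut c x y).
Proof.
move=> cx cy t; rewrite {2}/cut; have [tc|ct] := leP t c.
  apply: (cvg_trans _ (cx t)); apply: near_eq_cvg; near=> s.
  by rewrite /cut (le_trans _ tc)// ltW//; near: s; exact: nbhs_left_lt.
apply: (cvg_trans _ (cy t)); apply: near_eq_cvg; near=> s.
by rewrite /cut leNgt (_ : c < s)//; near: s; exact: nbhs_left_gt.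
Unshelve. all: by end_near. Qed.

(** With [0 <= c] the spliced path agrees with [x] on the left ray where paths must be constant;
    with [c <= T] it agrees with [y] beyond [T]. *)
Lemma spaceX_cut c x y : 0 <= c <= T -> spaceX T x -> spaceX T y ->
  spaceX T (cut c x y).
Proof.
move=> /andP[c0 cT] [cx bx x0 _] [cy by_ _ yT]; split.
- exact: left_continuous_cut.
- exact: bv_on_R_cut.
- by move=> s s0; rewrite /cut c0 (le_trans s0 c0) x0.
- by move=> s u Ts Tu; rewrite /cut !leNgt !(le_lt_trans cT)//= (yT _ u).
Qed.

Lemma spaceX_affine (l : R) (q : 'rV[R]_d) x : spaceX T x ->
  spaceX T (fun t => l *: x t + q).
Proof.
move=> [cx [M bx] x0 xT]; split.
- by move=> t; apply: cvgD; [apply: cvgZ; [exact: cvg_cst|exact: cx]|exact: cvg_cst].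
- exists (`|l| * M) => s ss; apply: le_trans (ler_wpM2l (normr_ge0 l) (bx s ss)).
  rewrite mulr_sumr ler_sum// => i _.
  by rewrite opprD addrACA subrr addr0 -scalerBr normrZ.
- by move=> s s0; rewrite x0.
- by move=> s u Ts Tu; rewrite (xT _ u).
Qed.

Lemma measurable_left_continuous x (O : set 'rV[R]_d) :
  left_continuous x -> open O -> measurable (x @^-1` O).
Proof. by move=> cx oO; apply: measurable_left_open; exact: left_open_preimage. Qed.

Lemma measurable_vec_left_continuous x : left_continuous x -> measurable_vec T x.
Proof.
move=> cx i; apply: (measurability _ (RGenOInfty.measurableE R)).
move=> _ [_ [c ->] <-]; apply: measurableI; first exact: measurable_itv.
apply: (measurable_left_continuous x ((fun v : 'rV[R]_d => v 0 i) @^-1` `]c, +oo[)) => //.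
by apply: open_comp; [move=> v _; exact: coord_continuous|exact: interval_open].
Qed.

End Paths.

(** * Rational approximation and convex functions on cubes *)

Section RowVectors.
Context {R : realType} {d : nat}.
Implicit Types (u v : 'rV[R]_d) (e : R).

Lemma rV_norm_leP v e : 0 <= e -> (`|v| <= e) <-> (forall i, `|v 0 i| <= e).
Proof.
move=> e0; rewrite /Num.Def.normr/= mx_normrE; split=> [/bigmax_leP[_ h] i|h].
  exact: (h (0, i)).
by apply/bigmax_leP; split=> // -[i j] _ /=; rewrite ord1; exact: h.
Qed.

Definition ratv (q : 'rV[rat]_d) : 'rV[R]_d := map_mx ratr q.

Lemma rat_dense_rV v e : 0 < e -> exists q, `|v - ratv q| < e.
Proof.
move=> e0; have e20 : 0 < e / 2 by rewrite divr_gt0.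
have /choice[q qP] (i : 'I_d) : exists r : rat, `|v 0 i - ratr r| <= e / 2.
  have [r] := @rat_in_itvoo R (v 0 i) (v 0 i + e / 2) ltac:(by rewrite ltrDl).
  rewrite in_itv/= => /andP[vr rv]; exists r.
  by rewrite distrC ger0_norm ?subr_ge0 1?ltW// ltrBlDl.
exists (\row_i q i); apply: (@le_lt_trans _ _ (e / 2)).
  by apply/rV_norm_leP; [exact: ltW|move=> i; rewrite !mxE; exact: qP].
by lra.
Qed.

(** The norm on row vectors is the sup norm, so these are the corners of its ball of radius [e]. *)
Definition cube_vertex e (s : {ffun 'I_d -> bool}) : 'rV[R]_d :=
  \row_i (if s i then e else - e).

Lemma norm_cube_vertex_le e s : 0 <= e -> `|cube_vertex e s| <= e.
Proof.
move=> e0; apply/rV_norm_leP => // i; rewrite mxE.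
by case: ifP => _; rewrite ?normrN ger0_norm.
Qed.

Definition convex_fun (g : 'rV[R]_d -> \bar R) := forall u v (l : R), 0 <= l <= 1 ->
  (g (l *: u + (1 - l) *: v)%R <= l%:E * g u + (1 - l)%:E * g v)%E.

Lemma convex_fun_le (g : 'rV[R]_d -> \bar R) u v (l a b : R) : convex_fun g ->
  0 <= l <= 1 -> (g u <= a%:E)%E -> (g v <= b%:E)%E ->
  (g (l *: u + (1 - l) *: v)%R <= (l * a + (1 - l) * b)%:E)%E.
Proof.
move=> cg /andP[l0 l1] ga gb; apply: (le_trans (cg _ _ _ _)); first exact/andP.
by rewrite [leRHS]EFinD !EFinM leeD// lee_wpmul2l// lee_fin// subr_ge0.
Qed.

Lemma convex_fun_cube (g : 'rV[R]_d -> \bar R) v (e M : R) : convex_fun g -> 0 < e ->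
  (forall s, (g (v + cube_vertex e s)%R <= M%:E)%E) ->
  forall u, `|u - v| <= e -> (g u <= M%:E)%E.
Proof.
move=> cg e0 gM.
(* Induction on the number [k] of leading coordinates allowed inside the cube, the others being [e]
   or [- e]. A free coordinate is removed by writing the point as a convex combination of its two
   projections onto opposite faces. *)
suff H k (u : 'rV[R]_d) : (forall i : 'I_d, `|u 0 i| <= e) ->
    (forall i : 'I_d, (k <= i)%N -> `|u 0 i| = e) -> (g (v + u)%R <= M%:E)%E.
  move=> u /(rV_norm_leP _ _ (ltW e0)) uv; rewrite -(subrKC v u).
  by apply: (H d) => // i; rewrite leqNgt ltn_ord.
elim: k u => [|k IH] u ue uk.
  rewrite (_ : u = cube_vertex e [ffun i => 0 <= u 0 i])//.
  apply/rowP => i; rewrite mxE ffunE; move: (uk i (leq0n _)) => <-.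
  by case: ifPn => [u0|]; [rewrite ger0_norm|rewrite -ltNge => u0;
    rewrite ltr0_norm// opprK].
have [kd|dk] := ltnP k d; last first.
  by apply: IH => // i ki; have := leq_ltn_trans ki (ltn_ord i); rewrite ltnNge dk.
pose j := Ordinal kd.
pose w c : 'rV[R]_d := \row_i (if i == j then c else u 0 i).
have we c : `|c| = e -> (g (v + w c)%R <= M%:E)%E.
  move=> ce; apply: IH => i; rewrite mxE; case: eqP => [_|ij]; rewrite ?ce//.
  move=> ki; apply: uk; rewrite ltn_neqAle ki andbT.
  by apply/eqP => kij; apply: ij; apply: val_inj.
pose l := (u 0 j + e) / (2 * e).
have /andP[uj0 uj1] : - e <= u 0 j <= e by rewrite -ler_norml.
have l01 : 0 <= l <= 1.
  by rewrite divr_ge0 ?ler_pdivrMr ?mulr_gt0//=; lra.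
have -> : v + u = l *: (v + w e) + (1 - l) *: (v + w (- e)).
  apply/rowP => i; rewrite !mxE; case: eqP => [->|_]; last by ring.
  by rewrite /l; field; rewrite gt_eqF.
have -> : M = l * M + (1 - l) * M by ring.
by apply: convex_fun_le => //; apply: we; rewrite ?normrN gtr0_norm.
Qed.

End RowVectors.

(** * Measurability of the integrand along a path and of its pointwise infimum *)

Section Measurability.
Context {R : realType} {d : nat} (T : R) (h : R -> 'rV[R]_d -> \bar R).
Hypothesis hnormal : convex_normal_integrand T h.

(** Since the epigraph is closed, [h t (x t) <= r] holds iff at every scale some rational ball
    contains [x t] while the ball around [(ratv q, r)] meets [epi h t]. Both conditions are
    measurable in [t], and the [q] are countable. *)
Lemma measurable_fun_integrand x : left_continuous x ->
  measurable_fun (I0T T) (fun t => h t (x t)).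
Proof.
have [_ _ cl mepi] := hnormal; move=> cx.
apply: (measurability _ (ErealGenOInfty.measurableE R)).
move=> _ [_ [r ->] <-].
pose F n (q : 'rV[rat]_d) := (x @^-1` ball (ratv q) n.+1%:R^-1) `&`
  [set t | I0T T t /\ (epi h t `&` ball (ratv q, r) n.+1%:R^-1) !=set0].
rewrite (_ : _ `&` _ = I0T T `\` (\bigcap_n \bigcup_q F n q)).
  apply: measurableD; first exact: measurable_itv.
  apply: bigcapT_measurable => n; apply: countable_bigcupT_measurable.
    exact: countableP.
  move=> q; apply: measurableI; last by apply: mepi; exact: ball_open.
  by apply: measurable_left_continuous => //; exact: ball_open.
apply/seteqP; split=> [t /= [It]|t /= [It nF]].
  rewrite in_itv/= andbT => rt; split=> // tF.
  suff : (h t (x t) <= r%:E)%E by rewrite leNgt rt.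
  suff : epi h t (x t, r) by [].
  apply: (cl t It) => B /nbhs_ballP[e /= e0 eB].
  have [n] := @ltr_add_invr R 0 (e / 2) ltac:(by rewrite divr_gt0).
  rewrite add0r => ne; have [q _ [/= xq [_ [p [hp qp]]]]] := tF n I.
  have [/= q1 q2] := qp; exists p; split=> //; apply: eB; split=> /=.
    by apply: (@ball_splitr R 'rV[R]_d (ratv q)); [apply: le_ball xq|apply: le_ball q1];
      exact: ltW.
  by apply: le_ball q2; apply: (le_trans (ltW ne)); rewrite ler_pdivrMr// ler_pMr// ler1n.
split=> //; rewrite in_itv/= andbT ltNge; apply/negP => hr; apply: nF => n _.
have [q xq] := rat_dense_rV (x t) n.+1%:R^-1 ltac:(by rewrite invr_gt0).
have bq : ball (ratv q) n.+1%:R^-1 (x t).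
  by rewrite mx_norm_ball /ball_/= distrC.
exists q => //; split => //; split=> //; exists (x t, r); split=> //.
by split=> //=; apply: ballxx; rewrite invr_gt0.
Qed.

(** The infimum is below [r] exactly when the epigraph meets the open half-space of points of height
    less than [r]. *)
Lemma measurable_fun_inf_integrand :
  measurable_fun (I0T T) (fun t => ereal_inf (range (h t))).
Proof.
have [hNy _ cl mepi] := hnormal.
apply: (measurability _ (ErealGenInftyO.measurableE R)).
move=> _ [_ [r ->] <-].
rewrite (_ : _ `&` _ =
  [set t | I0T T t /\ (epi h t `&` [set p | p.2 < r]) !=set0]).
  apply: mepi; apply: (@open_comp _ _ snd [set z | z < r]); last exact: open_lt.
  by move=> p _; exact: cvg_snd.
apply/seteqP; split=> t /= [It].
  rewrite in_itv/= => /ereal_inf_lt[_ [v _ <-] hr]; split=> //.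
  exists (v, fine (h t v)); rewrite /epi/= fineK ?fin_numE ?hNy ?lt_eqF//.
  - by split => //; rewrite -lte_fin fineK// fin_numE hNy// lt_eqF// (lt_trans hr)// ltry.
  - by rewrite (lt_trans hr)// ltry.
move=> [p [hp pr]]; split=> //; rewrite in_itv/=.
apply: (@le_lt_trans _ _ (h t p.1)); first by apply: ereal_inf_lbound; exists p.1.
by rewrite (le_lt_trans hp)// lte_fin.
Qed.

End Measurability.

(** * Countable sets are null for an atomless measure *)

Section Atomless.
Context {R : realType} (T : R) (mu : {measure set R -> \bar R}).
Hypothesis muA : atomless_on mu T.

Lemma atomless_countable (A : set R) : countable A -> A `<=` I0T T ->
  mu.-negligible A.
Proof.
move=> cA AI; have [->|/set0P[t0 At0]] := eqVneq A set0.
  exact: negligible_set0.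
have mu1 t : I0T T t -> mu [set t] = 0%E.
  move=> It; apply/eqP; rewrite -measure_le0 leNgt; apply/negP => mut.
  (* A charged singleton would be an atom: its only subsets are itself and the empty set. *)
  have [|B [mB Bt]] := muA _ (measurable_set1 t) _ mut; first by move=> _ ->.
  by have [->|->] := subset_set1 Bt; rewrite ?measure0 ?ltxx// andbF.
have /countable_injP[f injf] := cA.
apply: (@negligibleS _ _ _ _ (\bigcup_n (A `&` f @^-1` [set n]))).
  by move=> t At; exists (f t).
apply: negligible_bigcup => n.
have [->|/set0P[t [At ft]]] := eqVneq (A `&` f @^-1` [set n]) set0.
  exact: negligible_set0.
exists [set t]; split; [exact: measurable_set1|exact/mu1/AI|].
by move=> s [As fs]; apply: injf; rewrite ?inE//= fs ft.
Qed.

End Atomless.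

(** * A countable family of interior paths reaching the pointwise infimum *)

Section MinimizingSequence.
Context {R : realType} {d : nat} (T : R) (mu : {measure set R -> \bar R})
  (h : R -> 'rV[R]_d -> \bar R).
Hypothesis hnormal : convex_normal_integrand T h.
Implicit Types (l a b : R) (q : 'rV[R]_d).

Let hNy t v : I0T T t -> h t v != -oo%E.
Proof. by case: hnormal => + _ _ _ It; exact. Qed.

Let hconvex t : I0T T t -> convex_fun (h t).
Proof. by case: hnormal => _ + _ _ It; exact. Qed.

Lemma domh_fineK t v : I0T T t -> domh h t v -> ((fine (h t v))%:E = h t v)%E.
Proof. by move=> It hv; rewrite fineK// fin_numE hNy//= lt_eqF. Qed.

(** Interiority gives an almost-everywhere statement for one perturbation at a time. It is applied
    to the finitely many vertex translates of [x], and convexity then bounds [h t] on the whole cube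
    outside one common null set. *)
Lemma in_int_Linf_dom_cube x : left_continuous x -> in_int_Linf_dom mu T h x ->
  exists2 e : R, 0 < e & {ae mu, forall t, I0T T t ->
    exists M : R, forall u, `|u - x t| <= e -> (h t u <= M%:E)%E}.
Proof.
move=> cx [e e0 He]; exists e => //.
have Hs (s : {ffun 'I_d -> bool}) :
    {ae mu, forall t, I0T T t -> domh h t (x t + cube_vertex e s)}.
  apply: He => [|t It].
    apply: measurable_vec_left_continuous => t.
    by apply: cvgD; [exact: cx|exact: cvg_cst].
  by rewrite addrAC subrr add0r; apply: norm_cube_vertex_le; exact: ltW.
apply: filterS (filter_forall _ Hs) => t Ht It.
exists (\big[Num.max/0]_s fine (h t (x t + cube_vertex e s))).
apply: convex_fun_cube => // [|s]; first exact: hconvex.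
by rewrite -domh_fineK ?lee_fin ?le_bigmax//; exact: Ht.
Qed.

(* [l x + (1 - l) q + v = l (x + u) + (1 - l) z] with [|u| <= e]. *)
Lemma convex_fun_mix_le (g : 'rV[R]_d -> \bar R) (x q z v : 'rV[R]_d) (l e M c : R) :
  convex_fun g -> 0 < l < 1 -> (forall u, `|u - x| <= e -> (g u <= M%:E)%E) ->
  `|v| <= l * e / 2 -> `|q - z| <= l * e / 2 -> (g z <= c%:E)%E ->
  (g (l *: x + (1 - l) *: q + v)%R <= (l * M + (1 - l) * c)%:E)%E.
Proof.
move=> cg /andP[l0 l1] gM ve qz gz.
pose u := l^-1 *: (v + (1 - l) *: (q - z)).
have -> : l *: x + (1 - l) *: q + v = l *: (x + u) + (1 - l) *: z.
  by apply/rowP => i; rewrite !mxE; field; rewrite gt_eqF.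
apply: convex_fun_le => //; first by rewrite !ltW.
apply: gM; rewrite addrAC subrr add0r /u normrZ gtr0_norm ?invr_gt0//.
rewrite ler_pdivrMl// (le_trans (ler_normD _ _))// normrZ gtr0_norm ?subr_gt0//.
have : (1 - l) * `|q - z| <= 1 * `|q - z| by apply: ler_wpM2r => //; lra.
lra.
Qed.

(** The cube of radius [e] around [x0 t], scaled by [l], leaves a slack [l * e] around the mixture.
    Half of it pays for moving [q] into the domain, the other half for perturbing the path. *)
Definition near_dom (x0 : R -> 'rV[R]_d) (e l : R) (q : 'rV[R]_d) : set R :=
  [set t | I0T T t /\ (domh h t `&` ball q (l * e / 2)) !=set0].

Variable x0 : R -> 'rV[R]_d.
Hypotheses (Xx0 : spaceX T x0).
Variable e : R.
Hypotheses (e0 : 0 < e) (x0e : {ae mu, forall t, I0T T t ->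
    exists M : R, forall u, `|u - x0 t| <= e -> (h t u <= M%:E)%E}).

Definition mix_on (l : R) (q : 'rV[R]_d) (a b : R) : R -> 'rV[R]_d :=
  cut a x0 (cut b (fun t => l *: x0 t + (1 - l) *: q) x0).

Lemma mix_onE l q a b t : a < t <= b -> mix_on l q a b t = l *: x0 t + (1 - l) *: q.
Proof. by move=> /andP[at_ tb]; rewrite /mix_on /cut leNgt at_/= tb. Qed.

Lemma mix_onNE l q a b t : ~~ (a < t <= b) -> mix_on l q a b t = x0 t.
Proof. by rewrite negb_and -leNgt /mix_on /cut; case: leP => //= _ /negbTE ->. Qed.

Lemma near_dom_itv l q a b : a < b -> `]a, b] `<=` near_dom x0 e l q ->
  0 <= a /\ b <= T.
Proof.
move=> ab abS; split; last first.
  have [|] := abS b; first by rewrite /= in_itv/= ab lexx.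
  by rewrite /I0T/= in_itv/= => /andP[].
rewrite leNgt; apply/negP => a0.
(* For [a < 0] this is a negative point of []a, b]], hence outside [0,T]. *)
have [|+ _] := abS (Num.min b (a / 2)).
  by rewrite /= in_itv/= lt_min ge_min lexx ab/= andbT; lra.
by rewrite /I0T/= in_itv/= le_min => /andP[/andP[_]]; lra.
Qed.

Lemma mix_on_spaceX l q a b : a < b -> `]a, b] `<=` near_dom x0 e l q ->
  spaceX T (mix_on l q a b).
Proof.
move=> ab abS; have [a0 bT] := near_dom_itv _ _ _ _ ab abS.
apply: spaceX_cut => //; first by rewrite a0 (le_trans (ltW ab)).
apply: spaceX_cut => //; first by rewrite bT (le_trans a0)// ltW.
exact: spaceX_affine.
Qed.

Lemma mix_on_in_int l q a b : 0 < l < 1 -> `]a, b] `<=` near_dom x0 e l q ->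
  in_int_Linf_dom mu T h (mix_on l q a b).
Proof.
move=> l01 abS; have /andP[l0 l1] := l01.
exists (l * e / 2); first by rewrite divr_gt0// mulr_gt0.
move=> y my yp; apply: filterS x0e => t Mt It.
have [M hM] := Mt It; have := yp t It.
have [abt|abt] := boolP (a < t <= b); last first.
  rewrite mix_onNE// => ye; apply: (@le_lt_trans _ _ M%:E); last exact: ltry.
  apply: hM; apply: (le_trans ye).
  rewrite ler_pdivrMr// mulrC ler_wpM2l ?(ltW e0)//.
  by rewrite (le_trans (ltW l1))// ler1n.
rewrite mix_onE// => ye.
have [_ [z [hz]]] : near_dom x0 e l q t by apply: abS; rewrite /= in_itv.
rewrite mx_norm_ball /ball_/= => /ltW qz.
rewrite -(subrKC (l *: x0 t + (1 - l) *: q) (y t)).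
apply: (@le_lt_trans _ _ (l * M + (1 - l) * fine (h t z))%:E); last exact: ltry.
apply: (convex_fun_mix_le _ _ _ z _ _ e) => //; first exact: hconvex.
by rewrite domh_fineK.
Qed.

Hypotheses (hlisc : left_inner_semicontinuous T (domh h)) (muA : atomless_on mu T).

(** The origin is removed because a [tau_open] set may contain 0 without any point to its left. *)
Lemma near_dom_left_open l q : left_open (near_dom x0 e l q `\` [set 0]).
Proof.
move=> t [St t0]; have [_ H] := hlisc _ (ball_open q (l * e / 2)).
have [s st sS] := H _ St.
have t_gt0 : 0 < t.
  rewrite lt_neqAle eq_sym; apply/andP; split; first exact/eqP.
  by case: St; rewrite /I0T/= in_itv/= => /andP[].
exists (Num.max s 0); first by rewrite gt_max st.
move=> r; rewrite /= in_itv/= gt_max => /andP[/andP[sr r0] rt]; split.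
  by apply: sS => //; exact: ltW.
by move=> r00; rewrite r00 ltxx in r0.
Qed.

Let good (p : rat * 'rV[rat]_d * (rat * rat)) := [/\ 0 < (ratr p.1.1 : R) < 1,
  (ratr p.2.1 : R) < ratr p.2.2 &
  ratcell p.2 `<=` near_dom x0 e (ratr p.1.1) (ratv p.1.2)].

(** Enumerates all rational choices of weight, target and cell; invalid codes and inadmissible
    parameters fall back to [x0], so every index yields an interior path. *)
Definition minimizing_path (n : nat) : R -> 'rV[R]_d :=
  if (unpickle n : option (rat * 'rV[rat]_d * (rat * rat))) is Some p then
    if `[< good p >] then mix_on (ratr p.1.1) (ratv p.1.2) (ratr p.2.1) (ratr p.2.2)
    else x0
  else x0.

Lemma minimizing_path_spaceX n : spaceX T (minimizing_path n).
Proof.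
rewrite /minimizing_path; case: unpickle => // p; case: ifPn => // /asboolP[_ ab].
exact: mix_on_spaceX.
Qed.

Lemma minimizing_path_in_int n : in_int_Linf_dom mu T h x0 ->
  in_int_Linf_dom mu T h (minimizing_path n).
Proof.
move=> ix0; rewrite /minimizing_path; case: unpickle => // p.
by case: ifPn => // /asboolP[l01 _]; exact: mix_on_in_int.
Qed.

Lemma minimizing_path_inf : {ae mu, forall t, I0T T t -> forall c : R,
  (ereal_inf (range (h t)) < c%:E)%E ->
  exists n, (h t (minimizing_path n t) < c%:E)%E}.
Proof.
pose S (p : rat * 'rV[rat]_d) := near_dom x0 e (ratr p.1) (ratv p.2) `\` [set 0].
(* The exceptional times: the origin and, for each rational parameter, the points not covered by
   rational cells. They are countably many. *)
pose N := (I0T T `&` [set 0]) `|` \bigcup_p (S p `\` ratcells (S p)).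
have negN : mu.-negligible N.
  apply: negligibleU; apply: (atomless_countable _ _ muA); [|by move=> t []| |].
  - by apply: finite_set_countable; apply: sub_finite_set (finite_set1 0) => t [].
  - apply: bigcup_countable; first exact: countableP.
    by move=> p _; apply: left_open_ratcells; exact: near_dom_left_open.
  - by move=> t [p _ [[[]]]].
have aeN : {ae mu, forall t, ~ N t}.
  by apply: negligibleS negN => t /= /contrapT.
apply: filterS2 x0e aeN => t Mt Nt It c /ereal_inf_lt[_ [v _ <-] hc].
have [M hM] := Mt It.
have hv : domh h t v by apply: (lt_trans hc); exact: ltry.
rewrite -(domh_fineK t v) // lte_fin in hc; set c0 := fine _ in hc.
(* The weight [l] is small enough that mixing in the bound [M] raises the value [c0] by less than
   [c - c0]; the [+ 1] keeps the denominator positive. *)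
have [l] := @rat_in_itvoo R 0 (Num.min 1 ((c - c0) / (`|M - c0| + 1)))
  ltac:(by rewrite lt_min ltr01 divr_gt0 ?subr_gt0// ltr_wpDl).
rewrite in_itv/= lt_min => /and3P[l0 l1].
rewrite ltr_pdivlMr; last by rewrite ltr_wpDl.
move=> lc.
have lMc : ratr l * M + (1 - ratr l) * c0 < c.
  have : ratr l * (M - c0) <= ratr l * `|M - c0|.
    by apply: ler_wpM2l; [exact: ltW|exact: ler_norm].
  lra.
have [q vq] := rat_dense_rV v (ratr l * e / 2) ltac:(by rewrite divr_gt0// mulr_gt0).
have St : S (l, q) t.
  split; first split=> //.
    by exists v; split=> //; rewrite mx_norm_ball /ball_/= distrC.
  by move=> t0; apply: Nt; left.
have [[a b] abS] : ratcells (S (l, q)) t.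
  by apply: contrapT => nt; apply: Nt; right; exists (l, q).
rewrite {1}/ratcell/= in_itv/= => abt.
exists (pickle (l, q, (a, b))); rewrite /minimizing_path pickleK.
case: ifPn => [_|/asboolP[]]; last first.
  split=> //=; first by rewrite l0.
  - by case/andP: abt; exact: lt_le_trans.
  - by move=> r /abS[].
(* The mixture estimate is used with zero perturbation and the near-optimal point [v] as domain
   point. *)
rewrite /= mix_onE// -[X in h t X]addr0.
apply: (@le_lt_trans _ _ (ratr l * M + (1 - ratr l) * c0)%:E); last by rewrite lte_fin.
apply: (convex_fun_mix_le _ _ _ v _ _ e) => //.
- exact: hconvex.
- by rewrite l0.
- by rewrite normr0 divr_ge0// mulr_ge0// ltW.
- by rewrite distrC ltW.
- by rewrite domh_fineK.
Qed.

End MinimizingSequence.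

(** * L1-closures stable under splicing are decomposable *)

Section Decomposable.
Context {R : realType} (mu : {measure set R -> \bar R}) (D : set R).
Hypothesis mD : measurable D.
Implicit Types (f g k : R -> R) (A B : set R) (P : set (R -> R)).

Definition select A f g : R -> R := fun t => if t \in A then f t else g t.

Local Notation summable f := (mu.-integrable D (EFin \o f)).

Let summableW f : summable f -> measurable_fun D f.
Proof. by move=> /measurable_int /measurable_EFinP. Qed.

Let summable_add_norm f g : summable f -> summable g ->
  summable (fun t => `|f t| + `|g t|).
Proof.
by move=> fi gi; apply: (@integrableD _ _ _ _ _ mD (EFin \o (fun t => `|f t|))
  (EFin \o (fun t => `|g t|))); exact: integrable_norm.
Qed.

Let select_le A f g t : `|select A f g t| <= `|f t| + `|g t|.
Proof. by rewrite /select; case: ifP => _; rewrite ?lerDl ?lerDr. Qed.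

Lemma select_integrable A f g : measurable A -> summable f -> summable g ->
  summable (select A f g).
Proof.
move=> mA fi gi; apply: (le_integrable mD _ _ (summable_add_norm _ _ fi gi)).
  apply/measurable_EFinP; apply: measurable_fun_if => //.
  - apply: (measurable_fun_bool true); rewrite (_ : _ @^-1` _ = A).
      exact: measurableI.
    by apply/seteqP; split=> t /=; [exact: set_mem|exact: mem_set].
  - by apply: (measurable_funS mD _ (summableW _ fi)) => t [].
  - by apply: (measurable_funS mD _ (summableW _ gi)) => t [].
by move=> t _; rewrite /= lee_fin [leRHS]ger0_norm ?addr_ge0.
Qed.

Definition L1dist f g := (\int[mu]_(t in D) (`|f t - g t|)%:E)%E.

Let measurable_dist f g : summable f -> summable g ->
  measurable_fun D (fun t => (`|f t - g t|)%:E).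
Proof.
move=> /summableW mf /summableW mg; apply/measurable_EFinP.
by apply: measurableT_comp => //; exact: measurable_funB.
Qed.

(* Covers both the triangle inequality and the estimate for [select]. *)
Let L1dist_le_add f g f1 g1 f2 g2 : summable f -> summable g ->
    summable f1 -> summable g1 -> summable f2 -> summable g2 ->
  {ae mu, forall t, D t -> `|f t - g t| <= `|f1 t - g1 t| + `|f2 t - g2 t|} ->
  (L1dist f g <= L1dist f1 g1 + L1dist f2 g2)%E.
Proof.
move=> fi gi f1i g1i f2i g2i fg; rewrite /L1dist.
rewrite -ge0_integralD//; [|exact: measurable_dist..].
apply: ae_ge0_le_integral => //.
- exact: measurable_dist.
- by move=> t _; rewrite adde_ge0.
- by apply: emeasurable_funD; exact: measurable_dist.
Qed.

Definition L1closure P : set (R -> R) := [set f : R -> R | summable f /\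
  forall e : R, 0 < e -> exists k, [/\ P k, summable k & (L1dist k f <= e%:E)%E]].

Lemma L1closure_sub P f : P f -> summable f -> L1closure P f.
Proof.
move=> Pf fi; split=> // e e0; exists f; split=> //.
rewrite /L1dist; under eq_integral do rewrite subrr normr0.
by rewrite integral0 lee_fin ltW.
Qed.

Lemma L1closure_closed P f : summable f ->
  (forall e : R, 0 < e -> exists2 g, L1closure P g & (L1dist g f <= e%:E)%E) ->
  L1closure P f.
Proof.
move=> fi H; split=> // e e0; have e20 : 0 < e / 2 by rewrite divr_gt0.
have [g [gi Pg] gf] := H _ e20; have [k [Pk ki kg]] := Pg _ e20.
exists k; split=> //; apply: (@le_trans _ _ (L1dist k g + L1dist g f)%E).
  apply: L1dist_le_add => //; apply: aeW => t _.
  by rewrite -(subrKA (g t)) ler_normD.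
by rewrite [e](splitr e) EFinD leeD.
Qed.

Lemma L1closure_eq P f g : {in D, f =1 g} -> L1closure P f -> L1closure P g.
Proof.
move=> fg [fi Pf]; split.
  by apply: eq_integrable fi => // t tD; rewrite /= fg.
move=> e /Pf[k [Pk ki kf]]; exists k; split=> //.
by rewrite /L1dist; under eq_integral => t tD do rewrite -fg//.
Qed.

Section RaySplice.
Variable P : set (R -> R).
Hypothesis P_ray : forall c f g, P f -> P g -> exists2 k, P k &
  {ae mu, forall t, D t -> k t = select `]c, +oo[ f g t}.
Hypothesis P_summable : forall f, P f -> summable f.

Let splice := [set A | measurable A /\
  forall f g, L1closure P f -> L1closure P g -> L1closure P (select A f g)].

Let splice0 : splice set0.
Proof.
split=> // f g _ Pg; rewrite (_ : select _ _ _ = g)//.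
by apply/funext => t; rewrite /select in_set0.
Qed.

Let spliceC A : splice A -> splice (~` A).
Proof.
move=> [mA PA]; split=> [|f g Pf Pg]; first exact: measurableC.
rewrite (_ : select _ _ _ = select A g f); first exact: PA.
by apply/funext => t; rewrite /select in_setC; case: (t \in A).
Qed.

Let spliceU A B : splice A -> splice B -> splice (A `|` B).
Proof.
move=> [mA PA] [mB PB]; split=> [|f g Pf Pg]; first exact: measurableU.
rewrite (_ : select _ _ _ = select A f (select B f g)).
  by apply: PA => //; exact: PB.
by apply/funext => t; rewrite /select in_setU; case: (t \in A).
Qed.

(** The selections along the finite unions [B n] lie in the closure, are eventually constant in [n]
    at each point, and are dominated by [|f| + |g|]. Dominated convergence makes them converge in
    L1, and the closure is closed. *)
Let spliceV (F : nat -> set R) : (forall n, splice (F n)) -> splice (\bigcup_n F n).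
Proof.
move=> sF; have mF : measurable (\bigcup_n F n).
  by apply: bigcupT_measurable => n; case: (sF n).
pose B n := \big[setU/set0]_(i < n) F i.
have sB n : splice (B n).
  by apply: (big_ind splice) => // i _; exact: sF.
split=> // f g Pf Pg; have [fi _] := Pf; have [gi _] := Pg.
have ui := select_integrable _ _ _ mF fi gi.
have Bi n : summable (select (B n) f g) by apply: select_integrable => //; case: (sB n).
apply: L1closure_closed => // e e0.
have [] := @dominated_convergence _ _ _ mu D mD
  (fun n => EFin \o select (B n) f g) (EFin \o select (\bigcup_n F n) f g)
  (EFin \o (fun t => `|f t| + `|g t|)).
- by move=> n; exact: measurable_int (Bi n).
- exact: measurable_int ui.
- apply: aeW => t _; apply: cvg_near_cst.
  rewrite /select/=; case: (boolP (t \in \bigcup_n F n)) => [|tF].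
    rewrite inE => -[n _ Fnt]; near=> m.
    rewrite /= (_ : t \in B m)//; apply: mem_set.
    rewrite /B -bigcup_mkord; exists n => //=; near: m; exact: nbhs_infty_gt.
  near=> m; rewrite /= (_ : t \in B m = false)//; apply/negbTE.
  apply: contra tF => /set_mem; rewrite /B -bigcup_mkord => -[n _ Fnt].
  by apply: mem_set; exists n.
- exact: summable_add_norm.
- by apply: aeW => t n _; rewrite /= lee_fin; exact: select_le.
move=> _ + _ => cv0; apply: contrapT => nH.
suff : (e%:E <= 0)%E by rewrite lee_fin leNgt e0.
rewrite -(cvg_lim _ cv0)//; apply: lime_ge; first by apply/cvg_ex; exists 0%E.
near=> n; rewrite leNgt; apply/negP => ne; apply: nH.
by exists (select (B n) f g); [exact: (sB n).2|exact: ltW].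
Unshelve. all: by end_near. Qed.

(** Splice approximants of [f] and [g] inside [P]; the error of the splice is at most the sum of the
    two errors. *)
Let splice_ray c : splice `]c, +oo[.
Proof.
split=> [|f g [fi Pf] [gi Pg]]; first exact: measurable_itv.
have mc : measurable (`]c, +oo[ : set R) by exact: measurable_itv.
have sfg := select_integrable _ _ _ mc fi gi.
split=> // e e0; have e20 : 0 < e / 2 by rewrite divr_gt0.
have [f' [Pf' fi' ff']] := Pf _ e20; have [g' [Pg' gi' gg']] := Pg _ e20.
have [k Pk kE] := P_ray c f' g' Pf' Pg'.
exists k; split=> //; first exact: P_summable.
apply: (@le_trans _ _ (L1dist f' f + L1dist g' g)%E); last first.
  by rewrite [e](splitr e) EFinD leeD.
apply: L1dist_le_add => //; first exact: P_summable.
apply: filterS kE => t kt Dt; rewrite (kt Dt) /select.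
by case: ifP => _; rewrite ?lerDl ?lerDr.
Qed.

Lemma L1closure_select A f g : measurable A ->
  L1closure P f -> L1closure P g -> L1closure P (select A f g).
Proof.
move=> mA; suff [] : splice A by move=> _; exact.
have : <<s @RGenOInfty.G R >> A by rewrite -[<<s _ >>](RGenOInfty.measurableE R).
apply: smallest_sub.
  by split=> [|B|F] //; rewrite ?setTD; [exact: spliceC|exact: spliceV].
by move=> _ [c ->]; exact: splice_ray.
Qed.

(** The minimum is the selection of [f] on the set where [f <= g]. That set is intersected with [D],
    where measurability is known, so the identity is needed only on [D]. *)
Lemma L1closure_min f g : L1closure P f -> L1closure P g ->
  L1closure P (fun t => Num.min (f t) (g t)).
Proof.
move=> Pf Pg; have [/summableW mf _] := Pf; have [/summableW mg _] := Pg.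
have mA : measurable (D `&` [set t | f t <= g t]).
  have := @measurable_fun_ler _ _ _ D f g mf mg mD [set true] I.
  by rewrite [X in _ `&` X](_ : _ = [set t | f t <= g t]).
apply: L1closure_eq (L1closure_select _ _ _ mA Pf Pg) => t /set_mem Dt.
rewrite /select /Num.min; case: ifPn => [|]; last first.
  by move=> nA; case: ltP => // fg; case/negP: nA; apply: mem_set; split=> //=; exact: ltW.
rewrite inE => -[_ /=]; rewrite le_eqVlt => /predU1P[->|->//].
by rewrite ltxx.
Qed.

End RaySplice.
End Decomposable.

(** * The integral with the convention [+oo] *)

Section IintTheory.
Context {R : realType} (mu : {measure set R -> \bar R}) (T : R).
Implicit Types f g : R -> \bar R.

Let mI : measurable (I0T T). Proof. exact: measurable_itv. Qed.

(** If the positive part of [g] has infinite integral the right side is [+oo]. Otherwise both sides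
    are ordinary integrals, compared through positive and negative parts. *)
Lemma le_Iint f g : measurable_fun (I0T T) f -> measurable_fun (I0T T) g ->
  {ae mu, forall t, I0T T t -> (f t <= g t)%E} -> (Iint mu T f <= Iint mu T g)%E.
Proof.
move=> mf mg fg; rewrite /Iint.
have [gi|_] := boolP (\int[mu]_(t in I0T T) g^\+ t < +oo)%E; last by rewrite leey.
have fgp : (\int[mu]_(t in I0T T) f^\+ t <= \int[mu]_(t in I0T T) g^\+ t)%E.
  apply: ae_ge0_le_integral => //; [exact: measurable_funepos..|].
  by apply: filterS fg => t fgt It; rewrite !funeposE ge_max !le_max fgt//= lexx orbT.
rewrite (le_lt_trans fgp gi) (integralE _ _ f) (integralE _ _ g) leeB//.
apply: ae_ge0_le_integral => //; [exact: measurable_funeneg..|].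
by apply: filterS fg => t fgt It; rewrite !funenegE ge_max !le_max leeN2 fgt//= lexx orbT.
Qed.

Lemma Iint_integrable_eq f : mu.-integrable (I0T T) f ->
  Iint mu T f = (\int[mu]_(t in I0T T) f t)%E.
Proof. by move=> fi; rewrite /Iint integral_funepos_lt_pinfty. Qed.

(** A value below [+oo] bounds the positive part by convention; an infinite negative part would then
    force the value [-oo]. *)
Lemma integrable_Iint f : measurable_fun (I0T T) f ->
  (-oo < Iint mu T f < +oo)%E -> mu.-integrable (I0T T) f.
Proof.
move=> mf; rewrite /Iint; case: ifPn; last by rewrite ltxx andbF.
move=> fp /andP[fN _]; apply/integrableP; split=> //.
have -> : (\int[mu]_(t in I0T T) `|f t| =
    \int[mu]_(t in I0T T) (f^\+ t + f^\- t))%E.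
  by apply: eq_integral => t _; rewrite -[LHS]/((abse \o f) t) fune_abse.
rewrite ge0_integralD//; [|exact: measurable_funepos|exact: measurable_funeneg].
rewrite lte_add_pinfty// ltNge leye_eq; apply/negP => /eqP fn.
by move: fN; rewrite integralE fn addeNy ltxx.
Qed.

End IintTheory.

(** * Passing to the limit along running minima *)

Section MonotoneLimit.
Context {R : realType} (mu : {measure set R -> \bar R}) (T : R).
Variables (P : set (R -> R)) (V : R) (F : nat -> R -> R) (m : R -> \bar R).
Hypotheses
  (P_ray : forall c f g, P f -> P g -> exists2 k, P k &
    {ae mu, forall t, I0T T t -> k t = select `]c, +oo[ f g t})
  (P_summable : forall f, P f -> mu.-integrable (I0T T) (EFin \o f))
  (P_ge : forall f, P f -> (V%:E <= \int[mu]_(t in I0T T) (f t)%:E)%E)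
  (PF : forall n, P (F n))
  (mm : measurable_fun (I0T T) m)
  (Fm : {ae mu, forall t, I0T T t -> forall c : R, (m t < c%:E)%E ->
    exists n, F n t < c}).

Let mI : measurable (I0T T). Proof. exact: measurable_itv. Qed.

Fixpoint running_min n : R -> R := if n is n'.+1
  then fun t => Num.min (running_min n' t) (F n t) else F 0.

Let L1_running_min n : L1closure mu (I0T T) P (running_min n).
Proof.
have PL k : L1closure mu (I0T T) P (F k) by apply: L1closure_sub => //; exact: P_summable.
by elim: n => [|n IH] //=; apply: L1closure_min.
Qed.

(** The integral is continuous for the L1 distance, so the lower bound [V] passes from [P] to its
    closure. *)
Let L1closure_ge f : L1closure mu (I0T T) P f ->
  (V%:E <= \int[mu]_(t in I0T T) (f t)%:E)%E.
Proof.
move=> [fi H]; apply/lee_addgt0Pr => e e0; have [k [Pk ki kf]] := H _ e0.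
apply: (le_trans (P_ge _ Pk)); rewrite -leeBlDl//; last exact: integrable_fin_num.
rewrite -integralB_EFin//; apply: le_trans kf; apply: le_integral => //.
- exact: (integrableB mI ki fi).
- exact: (integrable_abse (integrableB mI ki fi)).
- by move=> t _; rewrite -EFinB lee_fin ler_norm.
Qed.

(** Measured downward from [F 0], the running minima become a nonnegative nondecreasing sequence,
    fit for monotone convergence. *)
Let gap n t := (F 0 t - running_min n t)%:E.

Let running_min_le n : forall t, running_min n t <= F 0 t.
Proof. by elim: n => [|n IH] t //=; rewrite ge_min IH. Qed.

Let running_min_leF n t : running_min n t <= F n t.
Proof. by case: n => [|n] //=; rewrite ge_min lexx orbT. Qed.

Let measurable_gap n : measurable_fun (I0T T) (gap n).
Proof.
have [/measurable_int/measurable_EFinP mr _] := L1_running_min n.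
have /measurable_int/measurable_EFinP mF := P_summable _ (PF 0).
by apply/measurable_EFinP; exact: measurable_funB.
Qed.

Let gap_nd t : {homo gap^~ t : k n / (k <= n)%N >-> (k <= n)%E}.
Proof.
apply/nondecreasing_seqP => n; rewrite /gap lee_fin lerD2l lerN2 /=.
by rewrite ge_min lexx.
Qed.

Let gap_ge0 n t : (0 <= gap n t)%E.
Proof. by rewrite /gap lee_fin subr_ge0. Qed.

(** Running minima stay in the closure, so each gap has integral at most that of [F 0] minus [V],
    and so does the limit [w]. Hence [F 0 - w] is integrable with integral at least [V], and it lies
    below [m] almost everywhere. *)
Lemma Iint_inf_ge : (V%:E <= Iint mu T m)%E.
Proof.
pose w t := limn (gap^~ t).
have w_ub t n : (gap n t <= w t)%E.
  rewrite /w (cvg_lim _ (ereal_nondecreasing_cvgn (gap_nd t)))//.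
  by apply: ereal_sup_ubound; exists n.
have w0 t : (0 <= w t)%E by apply: le_trans (w_ub t 0%N).
have mw : measurable_fun (I0T T) w.
  apply: (emeasurable_fun_cvg (fun n => gap n)) => // t _.
  exact: ereal_nondecreasing_is_cvgn.
have F0i := P_summable _ (PF 0).
have F0_fin := integrable_fin_num mI F0i.
have int_w : (\int[mu]_(t in I0T T) w t <= \int[mu]_(t in I0T T) (F 0 t)%:E - V%:E)%E.
  rewrite /w monotone_convergence//; apply: lime_le.
    apply: ereal_nondecreasing_is_cvgn; apply/nondecreasing_seqP => n.
    by apply: ge0_le_integral => // t _; exact: gap_nd.
  apply: nearW => n; have [ri _] := L1_running_min n.
  by rewrite /gap integralB_EFin// leeB//; exact: L1closure_ge.
have wi : mu.-integrable (I0T T) w.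
  apply/integrableP; split=> //; under eq_integral do rewrite gee0_abs//.
  by apply: (le_lt_trans int_w); rewrite -(fineK F0_fin) -EFinB ltry.
have ki : mu.-integrable (I0T T) ((EFin \o F 0) \- w)%E by exact: integrableB.
apply: (@le_trans _ _ (Iint mu T ((EFin \o F 0) \- w)%E)).
  rewrite Iint_integrable_eq// integralB//.
  by rewrite leeBrDr ?integrable_fin_num// -leeBrDl.
apply: le_Iint => //; first exact: measurable_int ki.
have := integrable_ae mI wi; apply: filterS2 Fm => t mt wt It /=.
(* If [m t < F 0 t - w t], some [F n t] is also below that value, which puts [gap n t] above its
   upper bound [w t]. *)
rewrite leNgt; apply/negP.
rewrite -(fineK (wt It)) -EFinB => /[dup] mlt /(mt It)[n].
rewrite ltNge => /negP; apply; rewrite lerBlDr -lerBlDl.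
rewrite -lee_fin fineK ?wt// (le_trans _ (w_ub t n))//.
by rewrite /gap lee_fin lerD2l lerN2.
Qed.

End MonotoneLimit.

(** * Assembly: infimum over paths against the pointwise infimum *)

Theorem theorem1 (R : realType) (d : nat) (T : R)
  (mu : {measure set R -> \bar R}) (h : R -> 'rV[R]_d -> \bar R) :
  0 < T -> (0 < d)%N ->
  convex_normal_integrand T h ->
  radon_on mu T -> atomless_on mu T -> support_is mu T ->
  left_inner_semicontinuous T (domh h) ->
  (forall x, spaceX T x ->
     (in_int_Linf_dom mu T h x -> (Ih mu T h x < +oo)%E) /\
     ((Ih mu T h x < +oo)%E ->
        forall t, I0T T t -> closure (domh h t) (x t))) ->
  (forall x, spaceX T x -> (-oo < Ih mu T h x)%E) ->
  (exists2 x, spaceX T x & (Ih mu T h x < +oo)%E) ->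
  (exists2 x, spaceX T x & in_int_Linf_dom mu T h x) ->
  ereal_inf [set Ih mu T h x | x in spaceX T] =
  Iint mu T (fun t => ereal_inf (range (h t))).
Proof.
move=> _ _ hn _ muA _ hlisc int_dom Ih_gtNy _ [x0 Xx0 ix0].
have mI : measurable (I0T T) by exact: measurable_itv.
have mh x : spaceX T x -> measurable_fun (I0T T) (fun t => h t (x t)).
  by move=> [cx _ _ _]; exact: measurable_fun_integrand.
have mm := measurable_fun_inf_integrand T h hn.
apply/eqP; rewrite eq_le; apply/andP; split; last first.
  apply/ereal_infP => _ [x Xx <-]; apply: le_Iint => //; first exact: mh.
  by apply: aeW => t _; apply: ereal_inf_lbound; exists (x t).
set V := ereal_inf _.
have Vlt x : spaceX T x -> (V <= Ih mu T h x)%E.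
  by move=> Xx; apply: ereal_inf_lbound; exists x.
have Ix0 : (Ih mu T h x0 < +oo)%E by apply: (int_dom _ Xx0).1.
(* For [V = -oo] nothing remains to be proved, and [V = +oo] is excluded by [x0]. *)
case VE : V Vlt => [v| |] Vlt; last by rewrite leNye.
  2: by have := Vlt _ Xx0; rewrite leNgt Ix0.
have Ih_int x : spaceX T x -> (Ih mu T h x < +oo)%E ->
    mu.-integrable (I0T T) (fun t => h t (x t)).
  by move=> Xx Ixy; apply: integrable_Iint; [exact: mh|rewrite Ih_gtNy].
(* Infinite values are replaced by 0, which changes an integrable integrand only on a null set. *)
pose fh x t := fine (h t (x t)).
have fhK x : mu.-integrable (I0T T) (fun t => h t (x t)) ->
    {ae mu, forall t, I0T T t -> ((fh x t)%:E = h t (x t))%E}.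
  move=> /(integrable_ae mI); apply: filterS => t ht It.
  by rewrite /fh fineK// ht.
have fhi x : mu.-integrable (I0T T) (fun t => h t (x t)) ->
    mu.-integrable (I0T T) (EFin \o fh x).
  move=> hi; apply: (le_integrable mI _ _ hi) => [|t _]; last first.
    by rewrite /= /fh; case: (h t (x t)) => [r| |]//=; rewrite normr0 leey.
  apply/measurable_EFinP; apply: (measurableT_comp (fine_measurable measurableT)).
  exact: measurable_int hi.
pose P := [set f : R -> R | exists2 x, spaceX T x & (Ih mu T h x < +oo)%E /\ f = fh x].
have [cx0 _ _ _] := Xx0.
have [e e0 x0e] := in_int_Linf_dom_cube T mu h hn x0 cx0 ix0.
pose F n := minimizing_path T h x0 e n.
have XF n : spaceX T (F n) by exact: minimizing_path_spaceX.
have IF n : (Ih mu T h (F n) < +oo)%E.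
  by apply: (int_dom _ (XF n)).1; exact: minimizing_path_in_int.
apply: (Iint_inf_ge _ _ P v (fun n => fh (F n))) => //.
- move=> c _ _ [x Xx [Ixy ->]] [y Xy [Iyy ->]].
  (* Paths can be cut only at times in [0,T]. For [c < 0] the ray covers [0,T], and for [c > T] it
     misses it, so one of the two given functions already serves. *)
  have [c0|c0] := ltP c 0.
    exists (fh x); first by exists x.
    apply: aeW => t; rewrite /I0T/= in_itv/= => /andP[t0 _].
    by rewrite /select mem_set//= in_itv/= (lt_le_trans c0).
  have [cT|Tc] := leP c T; last first.
    exists (fh y); first by exists y.
    apply: aeW => t; rewrite /I0T/= in_itv/= => /andP[_ tT].
    by rewrite /select memNset//= in_itv/= andbT; apply/negP; rewrite -leNgt (le_trans tT) ?ltW.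
  have fhE t : fh (cut c y x) t = select `]c, +oo[ (fh x) (fh y) t.
    rewrite /fh /cut /select; case: leP => tc.
      by rewrite memNset//= in_itv/= andbT; apply/negP; rewrite -leNgt.
    by rewrite mem_set//= in_itv/= tc.
  exists (fh (cut c y x)); last by apply: aeW => t _.
  have Xc : spaceX T (cut c y x) by apply: spaceX_cut; rewrite ?c0.
  exists (cut c y x) => //; split=> //.
  have hxi := Ih_int _ Xx Ixy; have hyi := Ih_int _ Xy Iyy.
  (* The spliced integrand is dominated by the sum of the absolute values of the two integrands. *)
  have hci : mu.-integrable (I0T T) (fun t => h t (cut c y x t)).
    apply: (le_integrable mI (mh _ Xc) _
      (integrableD mI (integrable_abse hxi) (integrable_abse hyi))).
    move=> t _; rewrite [leRHS]gee0_abs ?adde_ge0//= /cut; case: ifP => _.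
      by rewrite leeDr.
    by rewrite leeDl.
  by rewrite /Ih Iint_integrable_eq//; exact: integrable_lty.
- by move=> _ [x Xx [Ixy ->]]; apply: fhi; exact: Ih_int.
- move=> _ [x Xx [Ixy ->]]; have hi := Ih_int _ Xx Ixy.
  apply: (le_trans (Vlt _ Xx)); rewrite /Ih Iint_integrable_eq//.
  rewrite (_ : (\int[mu]_(t in I0T T) h t (x t) =
    \int[mu]_(t in I0T T) (EFin \o fh x) t)%E)//.
  apply: ae_eq_integral => //; [exact: mh|exact: measurable_int (fhi _ hi)|].
  by apply: filterS (fhK x hi) => t ht It; rewrite /= ht.
- by move=> n; exists (F n).
- have Fint n := Ih_int _ (XF n) (IF n).
  have aeF : {ae mu, forall t n, I0T T t -> ((fh (F n) t)%:E = h t (F n t))%E}.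
    by apply/ae_foralln => n; exact/fhK/Fint.
  apply: filterS2 (minimizing_path_inf T mu h hn x0 e e0 x0e hlisc muA) aeF.
  move=> t Ft ht It c /(Ft It c)[n hnc]; exists n.
  by rewrite -lte_fin ht.
Qed.
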